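(* Let $1\le d\le m$ be positive integers, let $\mathcal I=\{I_1,\dots,I_d\}$ be a partition of $\{1,\dots,m\}$ into non-empty disjoint sets (listed in this order), and let $\mathcal B_{\mathcal I}$ be the block of $\mathcal I$-type. Let $r\ge 1$, $\mathbf p=(p_1,\dots,p_m)$, $\mathbf q=(q_1,\dots,q_m)\in[1,\infty)^m$, and let $\mathbf s=(s_1,\dots,s_d)$ with $r\le s_d\le\cdots\le s_2\le s_1$ be such that $$\frac1{s_k}-\sum_{j\in\bigcup_{i=k}^d I_i}\frac1{q_j}=\frac1r-\sum_{j\in\bigcup_{i=k}^d I_i}\frac1{p_j},\qquad k=1,\dots,d.$$ Suppose that at least one of the following conditions holds: (A) $q_j\ge p_j$ for $j=1,\dots,m$, and $\frac1r-\sum_{j=1}^m\frac1{p_j}+\sum_{j=1}^m\frac1{q_j}>0$; (B) $q_1>p_1$, $q_j\ge p_j$ for $j=2,\dots,m$, and $\frac1r-\sum_{j=1}^m\frac1{p_j}+\sum_{j=1}^m\frac1{q_j}=0$. Then, for any Banach spaces $E_1,\dots,E_m,F$ over $\mathbb K$, $$\Pi^{\mathcal B_{\mathcal I}}_{(r;\mathbf p)}(E_1,\dots,E_m;F)\subset \Pi^{\mathcal B_{\mathcal I}}_{(\mathbf s;\mathbf q)}(E_1,\dots,E_m;F).$$ Moreover, the inclusion operator (with respect to the norms $\pi^{\mathcal B_{\mathcal I}}_{(r;\mathbf p)}$ and $\pi^{\mathcal B_{\mathcal I}}_{(\mathbf s;\mathbf q)}$) has norm $1$.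
   Context: $\mathbb K$ is $\mathbb R$ or $\mathbb C$. For a Banach space $E$ with dual $E^*$ (and $B_{E^*}$ the closed unit ball of $E^*$) and $p\in[1,\infty)$, $\ell_p^w(E)$ is the Banach space of sequences $(x_i)_{i\in\mathbb N}$ in $E$ with $\|(x_i)_i\|_{w,p}:=\sup_{x^*\in B_{E^*}}\left(\sum_{i=1}^\infty|x^*(x_i)|^p\right)^{1/p}<\infty$. Let $\mathcal I=\{I_1,\dots,I_d\}$ be a partition of $\{1,\dots,m\}$ into non-empty disjoint sets, with the order $I_1,\dots,I_d$ fixed. The block of $\mathcal I$-type, $\mathcal B_{\mathcal I}\subset\mathbb N^m$, is the set of all multi-indices whose $j$-th coordinate equals $i_n$ whenever $j\in I_n$, where $i_1,\dots,i_d$ range over $\mathbb N$. For $x_j\in E_j$, $x_j\cdot e_j$ denotes the element of $E_1\times\cdots\times E_m$ with $x_j$ in coordinate $j$ and $0$ elsewhere. Thus, given sequences $(x^j_i)_{i\in\mathbb N}$ in $E_j$ ($j=1,\dots,m$), $\sum_{n=1}^d\sum_{j\in I_n}x^j_{i_n}\cdot e_j$ is the $m$-tuple whose $j$-th coordinate is $x^j_{i_n}$, where $n$ is the index with $j\in I_n$. For $\mathbf t=(t_1,\dots,t_d)$ and $\mathbf u=(u_1,\dots,u_m)\in[1,\infty)^m$, the class $\Pi^{\mathcal B_{\mathcal I}}_{(\mathbf t;\mathbf u)}(E_1,\dots,E_m;F)$ consists of all $m$-linear operators $T:E_1\times\cdots\times E_m\to F$ for which there is a constant $C>0$ with $$\left(\sum_{i_1=1}^\infty\left(\cdots\left(\sum_{i_d=1}^\infty\left\|T\left(\sum_{n=1}^d\sum_{j\in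 I_n}x^j_{i_n}\cdot e_j\right)\right\|^{t_d}\right)^{\frac{t_{d-1}}{t_d}}\cdots\right)^{\frac{t_1}{t_2}}\right)^{\frac1{t_1}}\le C\prod_{j=1}^m\|(x^j_i)_{i\in\mathbb N}\|_{w,u_j}$$ for all $(x^j_i)_{i\in\mathbb N}\in\ell^w_{u_j}(E_j)$, $j=1,\dots,m$. The infimum of such $C$ is the norm $\pi^{\mathcal B_{\mathcal I}}_{(\mathbf t;\mathbf u)}(T)$. When a single number $r$ is written in place of $\mathbf t$, it means $\mathbf t=(r,\dots,r)$. Exponents $t_k$ may equal $\infty$ (with $1/\infty=0$), in which case the corresponding $\ell_{t_k}$-norm in the index $i_k$ is the supremum over $i_k$; in case (B) the defining relation gives $s_1=\infty$.
   Formalization: The claim that the inclusion operator has norm 1 is stated only when the class for (r;p) contains a nonzero operator; if that class is {0} (for example F = {0}), the inclusion has norm 0, so the claim fails. The inclusion of classes itself is unconditional. *)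

(* Defs.v *)
From HB Require Import structures.
From mathcomp Require Import all_boot all_order all_algebra.
From mathcomp Require Import all_classical all_reals all_analysis.
From mathcomp Require Import complex.

Set Implicit Arguments.
Unset Strict Implicit.
Unset Printing Implicit Defensive.

Import Order.TTheory GRing.Theory Num.Theory.
Import numFieldNormedType.Exports.

Local Open Scope ring_scope.

Variant real_or_complex := RealScalars | ComplexScalars.

Definition scalar_field (R : realType) (K : real_or_complex) : numFieldType :=
  match K with
  | RealScalars => R : numFieldType
  | ComplexScalars => (complex R : numFieldType)
  end.

Definition real_part (R : realType) (K : real_or_complex) : scalar_field R K -> R :=
  match K return scalar_field R K -> R with
  | RealScalars => id
  | ComplexScalars => @complex.Re R
  end.

(* The norm of a normedModType over a field K takes its values in K, hence in
   the complex numbers when K is complex; [rnorm] is the same norm with values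
   in the reals. *)
Definition rnorm (R : realType) (K : real_or_complex)
  (V : normedModType (scalar_field R K)) (x : V) : R := real_part `|x|.

Section weak_sequences.
Context {R : realType} {K : real_or_complex}.
Variable E : completeNormedModType (scalar_field R K).

Definition dual_norm (phi : {linear E -> (scalar_field R K)^o}) : \bar R :=
  ereal_sup [set (rnorm (phi x))%:E | x in [set x : E | rnorm x <= 1]]%classic.

Definition dual_ball : set {linear E -> (scalar_field R K)^o} :=
  [set phi : {linear E -> (scalar_field R K)^o} |
    continuous phi /\ (dual_norm phi <= 1)%E]%classic.

Definition weak_norm (p : R) (x : nat -> E) : \bar R :=
  ereal_sup [set ('N[counting]_(p%:E) [(fun i => (rnorm (phi (x i)))%:E)])%E
            | phi in dual_ball]%classic.

Definition weakly_summable (p : R) (x : nat -> E) : Prop :=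
  (weak_norm p x < +oo)%E.

End weak_sequences.

(* [mixed_norm [:: t_1; ..; t_d] f] is the norm of f in
   l_{t_1}(l_{t_2}(.. (l_{t_d}))), where f is a function of the index list
   [:: i_1; ..; i_d]; i_1 is the outermost index. For the counting measure the
   essential supremum is the supremum, so t_k = +oo gives the sup over i_k. *)
Fixpoint mixed_norm (R : realType) (t : seq (\bar R)) (f : seq nat -> \bar R) :
    \bar R :=
  if t is t1 :: t' then
    ('N[counting]_t1 [(fun i => mixed_norm t' (fun l => f (i :: l)))])%E
  else f [::].

Definition ordered_partition (d m : nat) (I : 'I_d -> {set 'I_m}) : Prop :=
  injective I /\ finset.partition [set I k | k : 'I_d] [set: 'I_m].

Section summing_operators.
Context {R : realType} {K : real_or_complex} {d m : nat}.
Variables (E : 'I_m -> completeNormedModType (scalar_field R K))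
  (F : completeNormedModType (scalar_field R K)).

Definition multilinear (T : (forall j, E j) -> F) : Prop :=
  forall (x : forall j, E j) (j : 'I_m) (a : scalar_field R K) (u v : E j),
    T (dfwith x j (a *: u + v)) = a *: T (dfwith x j u) + T (dfwith x j v).

Definition single (j : 'I_m) (v : E j) : forall k, E k := dfwith (fun k => 0 : E k) j v.

(* The index l = [:: i_1; ..; i_d] is read with positions counted from 0. *)
Definition block_tuple (I : 'I_d -> {set 'I_m}) (x : forall j, nat -> E j)
    (l : seq nat) : forall k, E k :=
  fun k => \sum_(n < d) \sum_(j in I n) single (x j (nth 0%N l n)) k.

Definition summing_bound (I : 'I_d -> {set 'I_m}) (t : 'I_d -> \bar R)
    (u : 'I_m -> R) (T : (forall j, E j) -> F) (C : R) : Prop :=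
  forall x : forall j, nat -> E j,
    (forall j, weakly_summable (u j) (x j)) ->
    (mixed_norm [seq t k | k : 'I_d]
       (fun l => (rnorm (T (block_tuple I x l)))%:E)
     <= C%:E * \prod_(j < m) weak_norm (u j) (x j))%E.

Definition summing (I : 'I_d -> {set 'I_m}) (t : 'I_d -> \bar R)
    (u : 'I_m -> R) : set ((forall j, E j) -> F) :=
  [set T : (forall j, E j) -> F |
    multilinear T /\ exists C : R, 0 < C /\ summing_bound I t u T C]%classic.

(* Equal to +oo when there is no such constant C. *)
Definition summing_norm (I : 'I_d -> {set 'I_m}) (t : 'I_d -> \bar R)
    (u : 'I_m -> R) (T : (forall j, E j) -> F) : \bar R :=
  ereal_inf [set C%:E | C in [set C : R | 0 < C /\ summing_bound I t u T C]]
    %classic.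

Definition inclusion_norm (I : 'I_d -> {set 'I_m}) (t : 'I_d -> \bar R)
    (u : 'I_m -> R) (t' : 'I_d -> \bar R) (u' : 'I_m -> R) : \bar R :=
  ereal_sup [set summing_norm I t' u' T
            | T in [set T | summing I t u T /\
                            (summing_norm I t u T <= 1)%E]]%classic.

End summing_operators.

(* Main.v *)
Require Import Defs.
From HB Require Import structures.
From mathcomp Require Import all_boot all_order all_algebra.
From mathcomp Require Import all_classical all_reals all_analysis.
From mathcomp Require Import complex ring lra.

Set Implicit Arguments.
Unset Strict Implicit.
Unset Printing Implicit Defensive.

Import Order.TTheory GRing.Theory Num.Theory.
Import numFieldNormedType.Exports.

Local Open Scope ring_scope.

(** Inclusion.  Put 1/a_j = 1/p_j - 1/q_j.  By Hoelder, multiplying a weakly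
    q_j-summable sequence by (mu_i^(1/a_j))_i, where mu >= 0 has sum at most 1,
    gives a weakly p_j-summable sequence without increasing the weak norm.  Using
    the same mu for all j in a block, the (r; p)-bound shows that
      A(i_1, .., i_d) = |T (..)|
    satisfies |prod_k mu_k(i_k)^(b_k) A|_(l_r) <= D for all mu_1, .., mu_d, where
    b_k is the sum of the 1/a_j over the k-th block, so 1/s_k = 1/s_(k+1) - b_k
    with s_(d+1) = r.  The mixed norm of A is then at most D by induction on d: for
    fixed mu_1, the l_r-norm over i_1 can be moved from innermost to outermost
    position, where it becomes an l_(s_2)-norm, because equal exponents commute and
    l_s-norms decrease in s; what remains is l_(s_1)-l_(s_2) duality in i_1.

    Norm at least 1.  Testing a nonzero T of the class on one-point sequences gives
    functionals of the dual balls that do not vanish, and testing it on uniform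
    weights on N points of a single block gives 1/r <= sum of 1/p_j over that block.
    Under this condition Hoelder bounds the (r; p)-norm of a rank one operator
    (psi_1 x .. x psi_m) v with |psi_j| = |v| = 1 by 1, while one-point sequences
    show that its (s; q)-norm is at least 1. *)

(** * Norms of l_p type for nonnegative sequences *)

Section lnorm_lemmas.
Context {R : realType}.
Local Open Scope ereal_scope.
Implicit Types (p : R) (s t : \bar R) (f g : nat -> \bar R).

Local Notation "'N_ p [ f ]" := (Lnorm counting p f).

Lemma lnorm_fin p f : (0 < p)%R -> (forall i, 0 <= f i) ->
  'N_p%:E[f] = (\sum_(k <oo) f k `^ p) `^ p^-1.
Proof.
move=> p0 f0; rewrite Lnorm_counting//; congr (_ `^ _).
by apply: eq_eseriesr => i _; rewrite gee0_abs.
Qed.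

Lemma lnorm_fin_poweR p f : (0 < p)%R -> (forall i, 0 <= f i) ->
  'N_p%:E[f] `^ p = \sum_(k <oo) f k `^ p.
Proof.
move=> p0 f0; rewrite lnorm_fin// -poweRrM mulVf ?gt_eqF// poweRe1//.
by apply: nneseries_ge0 => *; exact: poweR_ge0.
Qed.

(** Reduces upper bounds for norms to finite partial sums, where later estimates become real
    arithmetic. *)
Lemma lnorm_le_fin p f D : (0 < p)%R -> (forall i, 0 <= f i) -> 0 <= D ->
  'N_p%:E[f] <= D <-> (forall n, \sum_(0 <= k < n) f k `^ p <= D `^ p).
Proof.
move=> p0 f0 D0; have pf0 i : 0 <= f i `^ p by exact: poweR_ge0.
have in0y (x : \bar R) : 0 <= x -> x \in `[0, +oo] by rewrite in_itv/= leey andbT.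
split=> [fD n|fD].
  apply: le_trans (nneseries_lim_ge _ _) _ => //.
  by rewrite -lnorm_fin_poweR// gt0_ler_poweR ?in0y ?Lnorm_ge0// ltW.
have -> : D = (D `^ p) `^ p^-1 by rewrite -poweRrM mulfV ?gt_eqF// poweRe1.
rewrite lnorm_fin// gt0_ler_poweR ?in0y ?poweR_ge0 ?nneseries_ge0// ?invr_ge0 ?(ltW p0)//.
by apply: lime_le; [exact: is_cvg_nneseries | exact: nearW].
Qed.

Lemma lnorm_sum_le p f n : (0 < p)%R -> (forall i, 0 <= f i) ->
  \sum_(0 <= k < n) f k `^ p <= 'N_p%:E[f] `^ p.
Proof.
move=> p0 f0; rewrite lnorm_fin_poweR//.
by apply: nneseries_lim_ge => *; exact: poweR_ge0.
Qed.

(** Singletons have positive counting measure, so the null set off which the essential supremum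
    dominates [f] contains no index. *)
Lemma lnorm_pinfty f : (forall i, 0 <= f i) -> 'N_+oo[f] = ereal_sup (range f).
Proof.
move=> f0; have c0 i : 0 < (@counting nat R) [set i].
  rewrite /counting asboolT; last exact: finite_set1.
  by rewrite fset_set1 lte_fin ltr0n finmap.cardfs1.
have cT : 0 < (@counting nat R) [set: nat].
  by rewrite /counting asboolF//; exact: infinite_nat.
rewrite unlock /= cT; apply/eqP; rewrite eq_le; apply/andP; split.
  apply/ess_sup_inf.ess_supP/nearW => i /=; rewrite gee0_abs//.
  by apply: ereal_sup_ubound; exists i.
apply: ge_ereal_sup => _ [i _ <-].
have [A [mA A0 fA]] := ess_sup_inf.ess_sup_ge (@counting nat R) (abse \o f).
apply: contrapT => /negP; rewrite -ltNge => fi.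
have Ai : A i by apply: fA => /=; rewrite gee0_abs// leNgt fi.
have : (@counting nat R) [set i] <= (@counting nat R) A.
  by apply: le_measure; rewrite ?inE// => x ->.
by rewrite A0 leNgt c0.
Qed.

Lemma le_lnorm t f g : 0 < t -> (forall i, 0 <= f i) -> (forall i, f i <= g i) ->
  'N_t[f] <= 'N_t[g].
Proof.
move=> + f0 fg; have g0 i : 0 <= g i by exact: le_trans (fg i).
have in0y (x : \bar R) : 0 <= x -> x \in `[0, +oo] by rewrite in_itv/= leey andbT.
case: t => [p||//].
- rewrite lte_fin => p0; apply/lnorm_le_fin => //; first exact: Lnorm_ge0.
  move=> n.
  apply: le_trans (_ : \sum_(0 <= k < n) g k `^ p <= _); last first.
    exact: lnorm_sum_le.
  by apply: lee_sum => i _; rewrite gt0_ler_poweR ?in0y ?(ltW p0).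
- move=> _; rewrite !lnorm_pinfty//; apply: ge_ereal_sup => _ [i _ <-].
  by apply: le_trans (fg i) _; apply: ereal_sup_ubound; exists i.
Qed.

Lemma le_lnorm_coord t f i : 0 < t -> (forall i, 0 <= f i) -> f i <= 'N_t[f].
Proof.
move=> + f0; have in0y (x : \bar R) : 0 <= x -> x \in `[0, +oo].
  by rewrite in_itv/= leey andbT.
case: t => [p||//].
- rewrite lte_fin => p0.
  have := lnorm_sum_le i.+1 p0 f0; rewrite big_nat_recr//= => h.
  have {h} : f i `^ p <= 'N_p%:E[f] `^ p.
    by apply: le_trans h; rewrite leeDr// sume_ge0// => k _; exact: poweR_ge0.
  move=> /(@gt0_ler_poweR _ p^-1); rewrite -!poweRrM mulfV ?gt_eqF// !poweRe1 ?Lnorm_ge0//.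
  by apply; rewrite ?in0y ?poweR_ge0 ?invr_ge0 ?(ltW p0)//; exact: Lnorm_ge0.
- by move=> _; rewrite lnorm_pinfty//; apply: ereal_sup_ubound; exists i.
Qed.

(** With N the l_s-norm, each f_i is at most N, hence f_i^t <= f_i^s N^(t-s); summing gives N^t. *)
Lemma lnorm_nest s t f : 0 < s -> s <= t -> (forall i, 0 <= f i) ->
  'N_t[f] <= 'N_s[f].
Proof.
move=> s0 st f0; have fN i := le_lnorm_coord i s0 f0.
move: s0 st fN; case: t => [t||]; case: s => [s||]//=.
- rewrite lte_fin lee_fin => s0 st fN; have t0 := lt_le_trans s0 st.
  have [->|Nfin] := eqVneq 'N_s%:E[f] +oo; first exact: leey.
  have Nf : 'N_s%:E[f] \is a fin_num by rewrite ge0_fin_numE ?ltey ?Lnorm_ge0.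
  apply/lnorm_le_fin => //; first exact: Lnorm_ge0.
  have powD (x : \bar R) : 0 <= x -> x `^ t = x `^ s * x `^ (t - s).
    move=> x0; rewrite -poweRD; first by rewrite subrKC.
    by rewrite poweRD_defE subrKC gt_eqF.
  move=> n; apply: le_trans
    (_ : \sum_(0 <= k < n) f k `^ s * 'N_s%:E[f] `^ (t - s) <= _).
    apply: lee_sum => k _; rewrite powD// lee_wpmul2l ?poweR_ge0//.
    by rewrite gt0_ler_poweR ?in_itv/= ?leey ?andbT ?Lnorm_ge0 ?subr_ge0.
  rewrite -ge0_sume_distrl; last by move=> *; exact: poweR_ge0.
  rewrite powD ?Lnorm_ge0// lee_wpmul2r ?poweR_ge0//.
  exact: lnorm_sum_le.
- move=> s0 _ fN; rewrite lnorm_pinfty//.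
  by apply: ge_ereal_sup => _ [i _ <-].
Qed.

(** Tonelli for finite exponents; for the exponent +oo, two suprema commute. *)
Lemma lnorm_swap t (f : nat -> nat -> \bar R) : 0 < t -> (forall i j, 0 <= f i j) ->
  'N_t[(fun i => 'N_t[(f i)])] = 'N_t[(fun j => 'N_t[(f^~ j)])].
Proof.
case: t => [p||//] + f0.
- rewrite lte_fin => p0; have N0 g : 0 <= 'N_p%:E[g] by exact: Lnorm_ge0.
  rewrite lnorm_fin// [RHS]lnorm_fin//; congr (_ `^ _).
  under eq_eseriesr do rewrite lnorm_fin_poweR//.
  under [RHS]eq_eseriesr do rewrite lnorm_fin_poweR//.
  by rewrite nneseries_interchange// => i j; exact: poweR_ge0.
(* By symmetry in the two indices one inequality suffices. *)
- move=> _; wlog suff : f f0 / 'N_+oo[(fun i => 'N_+oo[(f i)])] <=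
      'N_+oo[(fun j => 'N_+oo[(f^~ j)])].
    by move=> h; apply/eqP; rewrite eq_le h//= (h (fun i j => f j i)).
  rewrite lnorm_pinfty; last by move=> i; exact: Lnorm_ge0.
  apply: ge_ereal_sup => _ [i _ <-].
  by apply: le_lnorm => // j; exact: (le_lnorm_coord (f := f^~ j)).
Qed.

Lemma lnormZ t (c : R) f : 0 < t -> (0 <= c)%R -> (forall i, 0 <= f i) ->
  'N_t[(fun i => c%:E * f i)] = c%:E * 'N_t[f].
Proof.
move=> + c0 f0; have cf0 i : 0 <= c%:E * f i by rewrite mule_ge0.
case: t => [p||//].
- rewrite lte_fin => p0; rewrite !lnorm_fin//.
  under eq_eseriesr do rewrite poweRM// poweR_EFin.
  rewrite nneseriesZl; last by move=> *; exact: poweR_ge0.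
  rewrite poweRM ?poweR_ge0 ?lee_fin ?powR_ge0//; last first.
    by apply: nneseries_ge0 => *; exact: poweR_ge0.
  by rewrite poweR_EFin -powRrM mulfV ?gt_eqF// powRr1.
- move=> _; rewrite !lnorm_pinfty//.
  have -> : range (fun i => c%:E * f i) = [set c%:E * x | x in range f]%classic.
    by rewrite image_comp.
  rewrite ereal_supZl//; apply/set0P; exists (f 0%N); by exists 0%N.
Qed.

Lemma lnorm0 t : 0 < t -> 'N_t[(fun=> 0) : nat -> \bar R] = 0.
Proof. by move=> t0; rewrite Lnorm0// gt_eqF. Qed.

End lnorm_lemmas.

(** * Mixed norms, exchange of exponents, duality against weights *)

Section mixed_norm_lemmas.
Context {R : realType}.
Local Open Scope ereal_scope.
Implicit Types (p : R) (t : \bar R) (ts : seq (\bar R)) (f g : seq nat -> \bar R).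

Local Notation "'N_ p [ f ]" := (Lnorm counting p f).

Lemma mixed_norm_ge0 ts f : (forall l, 0 <= f l) -> 0 <= mixed_norm ts f.
Proof. by case: ts => [|t ts] f0 //=; exact: Lnorm_ge0. Qed.

Lemma eq_mixed_norm ts f g :
  (forall l, size l = size ts -> f l = g l) -> mixed_norm ts f = mixed_norm ts g.
Proof.
elim: ts f g => [|t ts IH] f g /= fg; first exact: fg.
congr Lnorm; apply/funext => i; apply: IH => l ls.
by apply: fg; rewrite /= ls.
Qed.

Lemma le_mixed_norm_coord ts f l : all (fun t => 0 < t) ts -> (forall l, 0 <= f l) ->
  size l = size ts -> f l <= mixed_norm ts f.
Proof.
elim: ts f l => [|t ts IH] f [|i l]//= /andP[t0 ts0] f0 [ls].
apply: le_trans (IH (fun l => f (i :: l)) l _ _ _) _ => //.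
apply: (le_lnorm_coord (f := fun i => mixed_norm ts (fun l => f (i :: l)))) => //.
by move=> j; exact: mixed_norm_ge0.
Qed.

Lemma mixed_normZ ts (c : R) f : all (fun t => 0 < t) ts -> (0 <= c)%R ->
  (forall l, 0 <= f l) ->
  mixed_norm ts (fun l => c%:E * f l) = c%:E * mixed_norm ts f.
Proof.
elim: ts f => [|t ts IH] f //= /andP[t0 ts0] c0 f0.
rewrite -lnormZ//; last by move=> i; exact: mixed_norm_ge0.
by congr Lnorm; apply/funext => i; rewrite IH.
Qed.

(** The factor of the outermost index is a constant for the inner norms and can be pulled out, one
    index at a time. This is used to factorise the summing inequality of a rank one operator. *)
Lemma mixed_norm_prod ts (g : nat -> nat -> R) (G : nat -> R) :
  all (fun t => 0 < t) ts -> (forall n i, (0 <= g n i)%R) ->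
  (forall n, (n < size ts)%N -> 'N_(nth 0 ts n)[EFin \o g n] = (G n)%:E) ->
  mixed_norm ts (fun l => (\prod_(n < size ts) g n (nth 0%N l n))%:E) =
  (\prod_(n < size ts) G n)%:E.
Proof.
elim: ts g G => [|t ts IH] g G /=; first by rewrite !big_ord0.
move=> /andP[t0 ts0] g0 gG.
have G0 n : (n < (size ts).+1)%N -> (0 <= G n)%R.
  by move=> /gG nG; rewrite -lee_fin -nG Lnorm_ge0.
rewrite big_ord_recl/= EFinM -(gG 0%N)//= muleC -lnormZ//; last 2 first.
- by apply: prodr_ge0 => n _; apply: G0; rewrite ltnS ltn_ord.
- by move=> i; rewrite lee_fin.
congr Lnorm; apply/funext => i.
rewrite -(IH (fun n => g n.+1) (fun n => G n.+1))//; last by move=> n; exact: (gG n.+1).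
rewrite muleC -mixed_normZ//; last by move=> l; rewrite lee_fin prodr_ge0.
by apply: eq_mixed_norm => l _; rewrite big_ord_recl.
Qed.

Lemma mixed_norm_lnorm t n (f : nat -> seq nat -> \bar R) : 0 < t ->
  (forall i l, 0 <= f i l) ->
  'N_t[(fun i => mixed_norm (nseq n t) (f i))] =
  mixed_norm (nseq n t) (fun l => 'N_t[(f^~ l)]).
Proof.
move=> t0; elim: n f => [|n IH] f f0 //=.
rewrite lnorm_swap//; last by move=> i j; exact: mixed_norm_ge0.
by congr Lnorm; apply/funext => i; rewrite IH.
Qed.

(** One swap takes the norm in [i] past the equal exponent s_0; nesting then replaces its exponent
    by s_1, which matches the next norm to be passed. After n rounds it is innermost with exponent
    s_n. *)
Lemma mixed_norm_lnorm_le n (s : nat -> \bar R) (f : nat -> seq nat -> \bar R) :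
  (forall k, (k < n)%N -> s k.+1 <= s k) -> 0 < s n -> (forall i l, 0 <= f i l) ->
  'N_(s 0%N)[(fun i => mixed_norm (mkseq s n) (f i))] <=
  mixed_norm (mkseq s n) (fun l => 'N_(s n)[(f^~ l)]).
Proof.
elim: n s f => [|n IH] s f sn s0 f0 //.
have -> : mkseq s n.+1 = s 0%N :: mkseq (s \o S) n.
  by rewrite /mkseq/= -(addn0 1%N) iotaDl -map_comp.
(* Positivity passes from the last exponent to the earlier, larger ones: induction on n + 1 - k. *)
have s_gt0 k : (k <= n.+1)%N -> 0 < s k.
  move=> kn; have : (n.+1 - k <= n.+1)%N by rewrite leq_subr.
  rewrite -{2}(subKn kn); elim: (n.+1 - k)%N => [|j IHj] jn; first by rewrite subn0.
  apply: lt_le_trans (IHj (ltnW jn)) _.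
  by rewrite -(subnSK jn); apply: sn; rewrite subSS ltnS leq_subr.
rewrite /= lnorm_swap ?s_gt0//; last by move=> i j; exact: mixed_norm_ge0.
apply: le_lnorm; rewrite ?s_gt0// => i; first exact: Lnorm_ge0.
apply: le_trans (IH (s \o S) (fun j l => f j (i :: l)) _ _ _) => //=; last first.
  by move=> k kn; exact: sn.
by apply: lnorm_nest; rewrite ?s_gt0 ?sn// => j; exact: mixed_norm_ge0.
Qed.

(** Mass at most 1, stated through partial sums: weights that arise from Hoelder, such as (a_i /
    W)^p, satisfy only the inequality. *)
Definition subprob (mu : nat -> R) : Prop :=
  (forall i, (0 <= mu i)%R) /\ (forall n, \sum_(0 <= i < n) mu i <= 1)%R.

Lemma subprob_finite (mu : nat -> R) n : (forall i, 0 <= mu i)%R ->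
  (forall i, (n <= i)%N -> mu i = 0%R) -> (\sum_(0 <= i < n) mu i <= 1)%R ->
  subprob mu.
Proof.
move=> mu0 mun sum1; split=> // N; apply: le_trans sum1.
have [Nn|nN] := leqP N n.
  by rewrite [leRHS](big_cat_nat (leq0n N) Nn)//= lerDl sumr_ge0.
rewrite (big_cat_nat (leq0n n) (ltnW nN))//= gerDl big_nat_cond big1// => i.
by rewrite andbT => /andP[/mun].
Qed.

Lemma subprob_uniform n : (0 < n)%N ->
  subprob (fun i => if (i < n)%N then n%:R^-1 else 0)%R.
Proof.
move=> n0; apply: (@subprob_finite _ n).
- by move=> i; case: ifP => // _; rewrite invr_ge0 ler0n.
- by move=> i; rewrite ltnNge => ->.
- rewrite big_nat_cond (eq_bigr (fun=> n%:R^-1)%R); last first.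
    by move=> i /andP[/andP[_ ->]].
  by rewrite -big_nat_cond sumr_const_nat subn0 -[X in (X <= _)%R]mulr_natr mulVf// pnatr_eq0 -lt0n.
Qed.

Lemma subprob_dirac k : subprob (fun i => (i == k)%:R)%R.
Proof.
apply: (@subprob_finite _ k.+1) => [i|i ki|]; first by rewrite ler0n.
  by rewrite gtn_eqF.
rewrite big_nat_recr//= eqxx big_nat_cond big1 ?add0r// => i.
by rewrite andbT => /andP[_ ik]; rewrite ltn_eqF.
Qed.

(* For [b = 0] the weight [mu i `^ b] is 1 even where [mu i = 0]. *)
Lemma lnorm_dual s t (b : R) (B : nat -> \bar R) (D : R) :
  0 < s -> s <= t -> t^-1 = s^-1 - b%:E -> (0 <= b)%R ->
  (forall i, 0 <= B i) ->
  (forall mu : nat -> R, subprob mu ->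
    'N_s[(fun i => (mu i `^ b)%:E * B i)] <= D%:E) ->
  'N_t[B] <= D%:E.
Proof.
move=> s0 st tsb b0 B0 BD.
(* For b = 0 the exponents agree and any single weight will do. *)
have [b00|bN0] := eqVneq b 0%R.
  have -> : t = s by apply: (inv_inj (@inveK R)); rewrite tsb b00 sube0.
  have := BD _ (subprob_dirac 0%N).
  by rewrite b00; under eq_fun do rewrite powRr0 mul1e.
have {b0} b_gt0 : (0 < b)%R by rewrite lt_def bN0.
have [s' sE] : exists s', s = s'%:E.
  case: s s0 st tsb {BD} => [s'||]// _; first by exists s'.
  rewrite leye_eq => /eqP ->; rewrite invey sub0e => -[] /eqP.
  by rewrite eq_sym oppr_eq0 (negbTE bN0).
move: s0 st tsb BD; rewrite {}sE lte_fin => s0 st tsb BD {s}.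
(* Dirac weights bound each B_i by D; this makes [B] finite and settles t = +oo. *)
have BleD i : B i <= D%:E.
  apply: le_trans (BD _ (subprob_dirac i)).
  have := @le_lnorm_coord R s'%:E (fun j => ((j == i)%:R `^ b)%:E * B j) i.
  rewrite eqxx powR1 mul1e; apply; rewrite ?lte_fin// => j.
  by rewrite mule_ge0// lee_fin powR_ge0.
have D0 : (0 <= D)%R by rewrite -lee_fin (le_trans _ (BleD 0%N)).
pose Bf i := fine (B i).
have BE i : B i = (Bf i)%:E.
  by rewrite fineK// ge0_fin_numE// (le_lt_trans (BleD i))// ltry.
have Bf0 i : (0 <= Bf i)%R by rewrite -lee_fin -BE.
case: t st tsb => [t||//] st tsb; last first.
  by rewrite lnorm_pinfty//; apply: ge_ereal_sup => _ [i _ <-].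
rewrite lee_fin in st; have t0 := lt_le_trans s0 st.
have {}tsb : (t^-1 = s'^-1 - b)%R.
  by move: tsb; rewrite !inver !gt_eqF//= => -[].
apply/lnorm_le_fin => // n.
under eq_bigr do rewrite BE poweR_EFin.
rewrite sumEFin poweR_EFin lee_fin; set S := (\sum_(0 <= i < n) Bf i `^ t)%R.
have S_ge0 : (0 <= S)%R by apply: sumr_ge0 => *; exact: powR_ge0.
have [->|SN0] := eqVneq S 0%R; first exact: powR_ge0.
have S0 : (0 < S)%R by rewrite lt_def SN0.
(* The extremal weight: mu^(b s') B^s' becomes a multiple of B^t, since t b s' + s' = t. *)
pose mu i := (if (i < n)%N then Bf i `^ t / S else 0)%R.
have mu1 : subprob mu.
  apply: (@subprob_finite _ n).
  - by move=> i; rewrite /mu; case: ifP => // _; rewrite divr_ge0 ?powR_ge0.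
  - by move=> i; rewrite /mu ltnNge => ->.
  - rewrite big_nat_cond (eq_bigr (fun i => Bf i `^ t / S)%R); last first.
      by rewrite /mu => i /andP[/andP[_ ->]].
    by rewrite -big_nat_cond -mulr_suml divff.
have := BD mu mu1; have muB0 i : 0 <= (mu i `^ b)%:E * B i.
  by rewrite mule_ge0// lee_fin powR_ge0.
have D0' : 0 <= D%:E by rewrite lee_fin.
move=> /(lnorm_le_fin s0 muB0 D0').
have bsE : (1 - b * s' = s' / t)%R by rewrite tsb mulrBr mulfV ?gt_eqF// mulrC.
have tE : (t * (b * s') + s' = t)%R.
  rewrite -{2}[s'](@divfK _ t) ?gt_eqF// -bsE mulrBl mul1r addrC mulrC.
  by rewrite -addrA [(- _ + _)%R]addrC subrr addr0.
move=> /(_ n).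
rewrite big_nat_cond (eq_bigr (fun k => (S `^ (- (b * s')) * Bf k `^ t)%:E)); last first.
  move=> k /andP[/andP[_ kn] _]; rewrite /mu kn BE -EFinM poweR_EFin; congr EFin.
  have SV : (S^-1 `^ (b * s') = S `^ (- (b * s')))%R.
    by rewrite -(powR_inv1 S_ge0) -powRrM mulN1r.
  transitivity ((Bf k `^ t / S) `^ b `^ s' * Bf k `^ s')%R.
    exact: powRM (powR_ge0 _ _) (Bf0 k).
  rewrite -powRrM powRM ?powR_ge0 ?invr_ge0// SV -powRrM mulrAC mulrC -powRD tE//.
  by rewrite gt_eqF.
rewrite -big_nat_cond sumEFin poweR_EFin lee_fin -mulr_sumr -/S.
(* The left side is S^(1 - b s') = S^(s'/t); raising to the power t/s' gives S <= D^t. *)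
rewrite -{2}(powRr1 S_ge0) -powRD ?SN0 ?implybT// addrC bsE => h.
have := @ge0_ler_powR _ (t / s') _ _ _ _ _ h.
have tsE : (s' / t * (t / s') = 1)%R by rewrite mulrA divfK ?gt_eqF// divff ?gt_eqF.
have stE : (s' * (t / s') = t)%R by rewrite mulrCA divff ?mulr1 ?gt_eqF.
rewrite -!powRrM tsE stE powRr1//.
by apply; rewrite ?nnegrE ?powR_ge0// divr_ge0 ?ltW.
Qed.

(** Indices start at 0, so [s n] is the end value s_(d+1) = r of the recursion. Exponents are
    sequences on [nat] so that the induction can shift them by [S]. *)
Lemma mixed_norm_dual n (s : nat -> \bar R) (r : R) (b : nat -> R)
    (f : seq nat -> \bar R) (D : R) :
  (0 < r)%R -> s n = r%:E ->
  (forall k, (k < n)%N -> s k.+1 <= s k) ->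
  (forall k, (k < n)%N -> (s k)^-1 = (s k.+1)^-1 - (b k)%:E) ->
  (forall k, (k < n)%N -> (0 <= b k)%R) ->
  (forall l, 0 <= f l) ->
  (forall mu : nat -> nat -> R, (forall k, subprob (mu k)) ->
    mixed_norm (nseq n r%:E)
      (fun l => (\prod_(k < n) mu k (nth 0%N l k) `^ b k)%:E * f l) <= D%:E) ->
  mixed_norm (mkseq s n) f <= D%:E.
Proof.
move=> r0; elim: n s b f => [|n IH] s b f sn sdec sb b0 f0 fD.
  have := fD (fun=> fun i => (i == 0%N)%:R)%R (fun=> subprob_dirac 0%N).
  by rewrite /= big_ord0 mul1e.
have -> : mkseq s n.+1 = s 0%N :: mkseq (s \o S) n.
  by rewrite /mkseq/= -(addn0 1%N) iotaDl -map_comp.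
have s_gt0 k : (k <= n.+1)%N -> 0 < s k.
  move=> kn; have : (n.+1 - k <= n.+1)%N by rewrite leq_subr.
  rewrite -{2}(subKn kn); elim: (n.+1 - k)%N => [|j IHj] jn.
    by rewrite subn0 sn lte_fin.
  apply: lt_le_trans (IHj (ltnW jn)) _.
  by rewrite -(subnSK jn); apply: sdec; rewrite subSS ltnS leq_subr.
have sall : all (fun t => 0 < t) (mkseq (s \o S) n).
  by apply/allP => _ /mapP[k + ->]; rewrite mem_iota /= add0n => kn; rewrite s_gt0// ltnW.
have rall k : all (fun t => 0 < t) (nseq k r%:E) by rewrite all_nseq lte_fin r0 orbT.
have w0 (mu : nat -> nat -> R) k l :
    (0 <= \prod_(j < k) mu j (nth 0%N l j) `^ b j)%R.
  by apply: prodr_ge0 => j _; exact: powR_ge0.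
apply: (@lnorm_dual (s 1%N) (s 0%N) (b 0%N)).
- exact: s_gt0.
- exact: sdec.
- exact: sb.
- exact: b0.
- by move=> i; exact: mixed_norm_ge0.
move=> nu nu1.
pose g i l := (nu i `^ b 0%N)%:E * f (i :: l).
have g0 i l : 0 <= g i l by rewrite mule_ge0// lee_fin powR_ge0.
under eq_fun do rewrite -mixed_normZ ?powR_ge0//.
(* The norm over the first index moves innermost, where its exponent has become s_(n+1) = r. *)
apply: le_trans (mixed_norm_lnorm_le (s := s \o S) (f := g) _ _ _) _ => //=.
- by move=> k kn; exact: sdec.
- exact: s_gt0.
apply: (IH _ (b \o S)) => //=.
- by move=> k kn; exact: sdec.
- by move=> k kn; exact: sb.
- by move=> k kn; exact: b0.
- by move=> l; exact: Lnorm_ge0.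
(* The weight [nu] of the first index is put in front of the weights [mu] of the remaining ones. *)
move=> mu mu1; have := fD (fun k => if k is j.+1 then mu j else nu).
have mu1' k : subprob (if k is j.+1 then mu j else nu) by case: k.
move=> /(_ mu1'); apply: le_trans; rewrite sn/=.
rewrite le_eqVlt; apply/orP; left; apply/eqP.
pose w l := (\prod_(k < n) mu k (nth 0%N l k) `^ (b k.+1))%R.
have w0' l : (0 <= w l)%R by apply: prodr_ge0 => j _; exact: powR_ge0.
rewrite (_ : (fun l => _) = (fun l => 'N_r%:E[(fun i => (w l)%:E * g i l)])); last first.
  by apply/funext => l; rewrite lnormZ ?lte_fin.
(* All exponents are r now, so the innermost norm returns to the outermost place with equality. *)
rewrite -(@mixed_norm_lnorm _ _ (fun i l => (w l)%:E * g i l)) ?lte_fin//; last first.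
  by move=> i l; rewrite mule_ge0// lee_fin.
congr Lnorm; apply/funext => i; apply: eq_mixed_norm => l _.
by rewrite big_ord_recl/= EFinM muleC -!muleA; congr (_ * _); rewrite muleC.
Qed.

End mixed_norm_lemmas.

(** * Hoelder's inequality with several factors *)

Section hoelder.
Context {R : realType}.

Lemma powR_prod (J : Type) (l : seq J) (P : pred J) (x : J -> R) (r : R) :
  (forall j, P j -> 0 <= x j) ->
  (\prod_(j <- l | P j) x j) `^ r = \prod_(j <- l | P j) x j `^ r.
Proof.
move=> x0; suff [] : 0 <= \prod_(j <- l | P j) x j /\
    (\prod_(j <- l | P j) x j) `^ r = \prod_(j <- l | P j) x j `^ r by [].
elim/big_rec2: _ => [|j y z Pj [z0 <-]]; first by rewrite powR1.
by rewrite mulr_ge0 ?x0// powRM ?x0.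
Qed.

Lemma weighted_amgm (J : finType) (P : pred J) (th b : J -> R) :
  (forall j, 0 <= th j) -> (forall j, 0 <= b j) -> \sum_(j | P j) th j = 1 ->
  \prod_(j | P j) b j `^ th j <= \sum_(j | P j) th j * b j.
Proof.
move=> th0 b0 th1; set M := \sum_(j | P j) th j * b j.
have thb0 j : P j -> 0 <= th j * b j by move=> _; rewrite mulr_ge0.
have M_ge0 : 0 <= M by exact: sumr_ge0.
have [M0|MN0] := eqVneq M 0.
  (* The th_j sum to 1, so some th_j is nonzero; then b_j = 0 and the product vanishes. *)
  have /existsP[j /andP[Pj thj]] : [exists j, P j && (th j != 0)].
    rewrite -[X in is_true X]negbK negb_exists; apply/negP => /forallP thN.
    have := oner_neq0 R; rewrite -th1 big1 ?eqxx// => j Pj.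
    by have := thN j; rewrite Pj /= negbK => /eqP.
  have /eqP : th j * b j = 0.
    by move: M0 => /eqP; rewrite psumr_eq0// => /allP/(_ j (mem_index_enum _)); rewrite Pj => /eqP.
  rewrite mulf_eq0 (negbTE thj)/= => /eqP bj.
  by rewrite M0 (bigD1 j)//= bj powR0// mul0r.
have M_gt0 : 0 < M by rewrite lt_def MN0.
(* [b / M <= exp (b / M - 1)], and the exponents weighted by [th] sum to 0. *)
have le_exp j : b j `^ th j <= M `^ th j * expR (th j * (b j / M - 1)).
  have <- : expR (b j / M - 1) `^ th j = expR (th j * (b j / M - 1)).
    by rewrite /powR gt_eqF ?expR_gt0// expRK.
  rewrite -powRM ?expR_ge0//; apply: ge0_ler_powR => //.
  - by rewrite nnegrE.
  - by rewrite nnegrE mulr_ge0// expR_ge0.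
  have := expR_ge1Dx (b j / M - 1); rewrite addrC subrK => h.
  by rewrite -{1}[b j](@divfK _ M)// mulrC ler_wpM2l.
apply: (@le_trans _ _ (\prod_(j | P j) (M `^ th j * expR (th j * (b j / M - 1))))).
  by apply: ler_prod => j Pj; rewrite powR_ge0 le_exp.
rewrite big_split/= -expR_sum.
have -> : \sum_(j | P j) th j * (b j / M - 1) = 0.
  under eq_bigr do rewrite mulrBr mulr1 mulrA.
  by rewrite sumrB -mulr_suml -/M divff// th1 subrr.
rewrite expR0 mulr1 le_eqVlt; apply/orP; left; apply/eqP.
rewrite -[RHS]powRr1// -th1; elim/big_rec2: _ => [|j y x Pj ->]; first by rewrite powRr0.
by rewrite powRD// MN0 implybT.
Qed.

(** Once the exponents are divided by their sum T >= 1, weighted AM-GM bounds each product by a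
    convex combination of the b_j. As the b_j are at most 1, lowering the exponents only increases
    the powers. *)
Lemma subprob_prod (J : finType) (P : pred J) (th : J -> R) (b : J -> nat -> R) :
  (forall j, 0 <= th j) -> (forall j, P j -> subprob (b j)) ->
  1 <= \sum_(j | P j) th j ->
  subprob (fun i => \prod_(j | P j) b j i `^ th j).
Proof.
move=> th0 bP th1; split=> [i|n]; first by apply: prodr_ge0 => j _; exact: powR_ge0.
set T := \sum_(j | P j) th j.
have T0 : 0 < T by exact: lt_le_trans th1.
(* Zero off [P], because AM-GM is stated for families nonnegative at every index. *)
pose b' j i := if P j then b j i else 0.
have b'0 j i : 0 <= b' j i by rewrite /b'; case: ifP => // /bP[].
have b'1 j i : b' j i <= 1.
  rewrite /b'; case: ifP => // Pj; have [bj0 /(_ i.+1)] := bP j Pj.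
  by apply: le_trans; rewrite big_nat_recr//= lerDr sumr_ge0.
(* At b' = 0 the convention 0^0 = 1 does no harm: th_j and th_j / T vanish together. *)
have le_b j i : b' j i `^ th j <= b' j i `^ (th j / T).
  have [->|bN0] := eqVneq (b' j i) 0.
    have [->|thN0] := eqVneq (th j) 0; first by rewrite mul0r.
    by rewrite powR0// powR_ge0.
  by apply: ger_powR; rewrite ?lt_def ?bN0 ?b'0 ?b'1// ler_pdivrMr// ler_peMr.
apply: (@le_trans _ _ (\sum_(0 <= i < n) \sum_(j | P j) th j / T * b' j i)).
  apply: ler_sum => i _.
  apply: (@le_trans _ _ (\prod_(j | P j) b' j i `^ (th j / T))).
    by apply: ler_prod => j Pj; rewrite powR_ge0/=; have := le_b j i; rewrite /b' Pj.
  apply: weighted_amgm => // [j|]; first by rewrite divr_ge0// ltW.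
  by rewrite -mulr_suml divff// gt_eqF.
rewrite exchange_big/= -[leRHS](@divff _ T) ?gt_eqF// [leRHS]mulr_suml.
apply: ler_sum => j Pj; rewrite -mulr_sumr ler_piMr ?divr_ge0// ?(ltW T0)//.
by have [_] := bP j Pj; rewrite /b' Pj.
Qed.

Local Notation "'N_ p [ f ]" := (Lnorm counting p f).

(** The normalised powers (a_j / W_j)^(p_j) are subprobability weights. Their product with exponents
    r / p_j, which sum to at least 1, is again one, and it is the r-th power of the normalised
    product. *)
Lemma lnorm_prod_le (J : finType) (P : pred J) (r : R) (p W : J -> R) (a : J -> nat -> R) :
  0 < r -> (forall j, 0 < p j) -> (forall j, 0 <= W j) -> (forall j i, 0 <= a j i) ->
  r^-1 <= \sum_(j | P j) (p j)^-1 ->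
  (forall j, P j -> 'N_((p j)%:E)[EFin \o a j] <= (W j)%:E)%E ->
  ('N_(r%:E)[(fun i => (\prod_(j | P j) a j i)%:E)] <= (\prod_(j | P j) W j)%:E)%E.
Proof.
move=> r0 p0 W0 a0 rp aW.
have aWi j i : P j -> a j i <= W j.
  move=> Pj; rewrite -lee_fin; apply: le_trans (aW j Pj).
  by apply: (@le_lnorm_coord R _ (EFin \o a j)) => [|k]; rewrite ?lte_fin ?lee_fin.
(* If some W_j is 0, then a_j and the whole product vanish; otherwise division by W_j is allowed. *)
have [/existsP[j /andP[Pj /eqP Wj]]|] := boolP [exists j, P j && (W j == 0)].
  rewrite (_ : (fun i => _) = (fun=> 0%E)) ?lnorm0 ?lte_fin//.
    by rewrite lee_fin prodr_ge0.
  apply/funext => i; rewrite (bigD1 j)//= (_ : a j i = 0) ?mul0r//.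
  by apply/eqP; rewrite eq_le a0 andbT -Wj aWi.
rewrite negb_exists => /forallP WN.
have {WN} Wgt0 j : P j -> 0 < W j.
  by move=> Pj; have := WN j; rewrite Pj/= => WjN0; rewrite lt_def WjN0 W0.
pose b j i := (a j i / W j) `^ p j.
have bP j : P j -> subprob (b j).
  move=> Pj; split=> [i|n]; first exact: powR_ge0.
  have Wp0 : 0 < W j `^ p j by rewrite powR_gt0 ?Wgt0.
  rewrite -(ler_pM2l Wp0) mulr1 mulr_sumr.
  have a0' i : (0 <= (EFin \o a j) i)%E by rewrite lee_fin.
  have W0' : (0 <= (W j)%:E)%E by rewrite lee_fin.
  have := (lnorm_le_fin (p0 j) a0' W0').1 (aW j Pj) n.
  under eq_bigr do rewrite /= ?poweR_EFin.
  rewrite sumEFin lee_fin; apply: le_trans; apply: ler_sum => i _.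
  rewrite -powRM ?divr_ge0// mulrC divfK// gt_eqF// Wgt0//.
have th0 j : 0 <= r / p j by rewrite divr_ge0 ?ltW.
have th1 : 1 <= \sum_(j | P j) r / p j.
  by rewrite -mulr_sumr -(@divff _ r) ?gt_eqF// ler_pM2l.
have [_ sub1] := subprob_prod th0 bP th1.
have PW0 : 0 <= \prod_(j | P j) W j by apply: prodr_ge0.
apply/lnorm_le_fin => [//|i||n]; rewrite ?lee_fin ?prodr_ge0//.
under eq_bigr do rewrite /= ?poweR_EFin.
rewrite sumEFin poweR_EFin lee_fin -[leRHS]mulr1.
apply: le_trans (ler_wpM2l (powR_ge0 _ _) (sub1 n)).
rewrite mulr_sumr le_eqVlt; apply/orP; left; apply/eqP; apply: eq_bigr => i _.
rewrite !powR_prod// -big_split/=; apply: eq_bigr => j Pj.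
rewrite -powRrM [p j * _]mulrC divfK ?gt_eqF// -powRM ?divr_ge0//.
by rewrite mulrC divfK// gt_eqF// Wgt0.
Qed.

(** Hoelder for two factors, indexed by [bool]: for p < q the weight mu^(1/p - 1/q) has norm at most
    1 in l_a with 1/a = 1/p - 1/q. *)
Lemma lnorm_subprob_le (p q W : R) (mu a : nat -> R) :
  0 < p -> p <= q -> 0 <= W -> (forall i, 0 <= a i) -> subprob mu ->
  ('N_q%:E[EFin \o a] <= W%:E)%E ->
  ('N_p%:E[(fun i => (mu i `^ (p^-1 - q^-1) * a i)%:E)] <= W%:E)%E.
Proof.
move=> p0 pq W0 a0 [mu0 mu1] aW; have q0 := lt_le_trans p0 pq.
have [pqE|pqN] := eqVneq p q.
  rewrite pqE subrr (_ : (fun i => _) = EFin \o a)//.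
  by apply/funext => i; rewrite powRr0 mul1r.
have al0 : 0 < p^-1 - q^-1 by rewrite subr_gt0 ltf_pV2 ?posrE// lt_neqAle pqN.
rewrite (_ : W = \prod_(c : bool) if c then 1 else W); last first.
  by rewrite big_bool/= mul1r.
rewrite (_ : (fun i => _) = (fun i =>
    (\prod_(c : bool) if c then mu i `^ (p^-1 - q^-1) else a i)%:E)); last first.
  by apply/funext => i; rewrite big_bool.
apply: (@lnorm_prod_le bool predT p (fun c => if c then (p^-1 - q^-1)^-1 else q)
  (fun c => if c then 1 else W)
  (fun c i => if c then mu i `^ (p^-1 - q^-1) else a i)) => //;
  try by case=> *; rewrite ?invr_gt0 ?powR_ge0.
  by rewrite big_bool/= invrK subrK.
case=> // _; apply/lnorm_le_fin => [|i||n]; rewrite ?invr_gt0 ?lee_fin ?powR_ge0//.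
under eq_bigr do rewrite /= -powRrM mulfV ?gt_eqF// powRr1//.
by rewrite sumEFin poweR_EFin powR1 lee_fin.
Qed.

End hoelder.

(** * Real-valued absolute values and norms over the scalar field *)

Section scalars.
Context {R : realType} {K : real_or_complex}.

Definition scalar_of_real (K : real_or_complex) : R -> scalar_field R K :=
  match K return R -> scalar_field R K with
  | RealScalars => id
  | ComplexScalars => fun a => (a%:C)%C
  end.

Local Notation emb := (scalar_of_real K).

Lemma real_partK a : real_part (emb a) = a.
Proof. by case: K. Qed.

Lemma scalar_of_realM a b : emb (a * b) = emb a * emb b.
Proof. by case: K => //=; rewrite rmorphM. Qed.

Lemma scalar_of_real_ge0 a : 0 <= a -> 0 <= emb a.
Proof. by case: K => //= a0; rewrite ler0c. Qed.

Lemma ge0_scalarE (u : scalar_field R K) : 0 <= u -> u = emb (real_part u).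
Proof.
case: K u => //= u; rewrite complex.lecE => /andP[/eqP Iu _].
by case: u Iu => a b /= ->.
Qed.

Lemma real_part_ge0 (u : scalar_field R K) : 0 <= u -> 0 <= real_part u.
Proof. by case: K u => //= u; rewrite complex.lecE => /andP[]. Qed.

Definition scalar_abs (a : scalar_field R K) : R := real_part `|a|.

Lemma scalar_abs_real a : 0 <= a -> scalar_abs (emb a) = a.
Proof. by move=> a0; rewrite /scalar_abs ger0_norm ?real_partK// scalar_of_real_ge0. Qed.

Lemma scalar_absM a b : scalar_abs (a * b) = scalar_abs a * scalar_abs b.
Proof.
rewrite /scalar_abs normrM (ge0_scalarE (normr_ge0 a)) (ge0_scalarE (normr_ge0 b)).
by rewrite -scalar_of_realM !real_partK.
Qed.

Lemma scalar_abs_prod (J : Type) (l : seq J) (P : pred J) (c : J -> scalar_field R K) :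
  scalar_abs (\prod_(j <- l | P j) c j) = \prod_(j <- l | P j) scalar_abs (c j).
Proof.
elim/big_rec2: _ => [|j y x _ <-]; last by rewrite scalar_absM.
by rewrite /scalar_abs normr1; case: K.
Qed.

Variable V : normedModType (scalar_field R K).
Implicit Types x y : V.

Lemma rnorm_ge0 x : 0 <= rnorm x.
Proof. exact: real_part_ge0. Qed.

Lemma rnormZ a x : rnorm (a *: x) = scalar_abs a * rnorm x.
Proof.
rewrite /rnorm /scalar_abs normrZ (ge0_scalarE (normr_ge0 a)) (ge0_scalarE (normr_ge0 x)).
by rewrite -scalar_of_realM !real_partK.
Qed.

Lemma rnormZ_real a x : 0 <= a -> rnorm (emb a *: x) = a * rnorm x.
Proof. by move=> a0; rewrite rnormZ scalar_abs_real. Qed.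

Lemma rnorm0 : rnorm (0 : V) = 0.
Proof. by rewrite /rnorm normr0; case: K. Qed.

Lemma rnorm_gt0 x : x != 0 -> 0 < rnorm x.
Proof.
move=> x0; rewrite lt_def rnorm_ge0 andbT; apply: contra x0 => /eqP x0.
rewrite -normr_eq0 (ge0_scalarE (normr_ge0 x)) [real_part _]x0; apply/eqP.
by case: K.
Qed.

End scalars.

Arguments scalar_of_real {R} K.

(** * Weak norms of weighted sequences *)

Section weak_norm_lemmas.
Context {R : realType} {K : real_or_complex}.
Variable E : completeNormedModType (scalar_field R K).
Implicit Types (phi : {linear E -> (scalar_field R K)^o}) (x : nat -> E) (p q : R).

Local Notation "'N_ p [ f ]" := (Lnorm counting p f).

Lemma dual_norm_le phi (y : E) : (dual_norm phi <= 1)%E -> rnorm (phi y) <= rnorm y.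
Proof.
move=> phi1; have [->|y0] := eqVneq y 0; first by rewrite linear0 !rnorm0.
have ny := rnorm_gt0 y0.
have z1 : rnorm (scalar_of_real K (rnorm y)^-1 *: y) <= 1.
  by rewrite rnormZ_real ?invr_ge0 ?rnorm_ge0// mulVf// gt_eqF.
have : ((rnorm (phi (scalar_of_real K (rnorm y)^-1 *: y)))%:E <= 1)%E.
  by apply: le_trans phi1; apply: ereal_sup_ubound; exists (scalar_of_real K (rnorm y)^-1 *: y).
rewrite lee_fin linearZ/= rnormZ_real ?invr_ge0 ?rnorm_ge0//.
by rewrite mulrC ler_pdivrMr// mul1r.
Qed.

(** The zero functional lies in the dual ball, so the supremum is not the empty one, -oo. *)
Lemma weak_norm_ge0 p x : (0 <= weak_norm p x)%E.
Proof.
pose z : {linear E -> (scalar_field R K)^o} := (\0 : E -> (scalar_field R K)^o).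
have z0 y : rnorm (z y) = 0 by rewrite rnorm0.
apply: le_trans (ereal_sup_ubound (_ : _ ('N_p%:E[(fun i => (rnorm (z (x i)))%:E)]))%E).
  exact: Lnorm_ge0.
exists z => //; split; first by move=> y; exact: cst_continuous.
by apply: ge_ereal_sup => _ [y _ <-]; rewrite z0 lee_fin.
Qed.

Lemma weak_norm_subprob p q x (mu : nat -> R) : 0 < p -> p <= q -> subprob mu ->
  weakly_summable q x ->
  (weak_norm p (fun i => scalar_of_real K (mu i `^ (p^-1 - q^-1)) *: x i)
   <= weak_norm q x)%E.
Proof.
move=> p0 pq mu1 xq; apply: ge_ereal_sup => _ [phi phi1 <-].
have le_phi : ('N_q%:E[(fun i => (rnorm (phi (x i)))%:E)] <= weak_norm q x)%E.
  by apply: ereal_sup_ubound; exists phi.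
have wE : weak_norm q x = (fine (weak_norm q x))%:E.
  by rewrite fineK// ge0_fin_numE// (le_trans _ le_phi)// Lnorm_ge0.
move: le_phi; rewrite wE => le_phi.
rewrite (_ : (fun i => _) = (fun i => (mu i `^ (p^-1 - q^-1) * rnorm (phi (x i)))%:E)).
  apply: lnorm_subprob_le => //; last by move=> i; exact: rnorm_ge0.
  by rewrite -lee_fin (le_trans _ le_phi)// Lnorm_ge0.
by apply/funext => i; rewrite linearZ/= rnormZ_real ?powR_ge0.
Qed.

(** The sum of c_i |phi(y)|^p is at most B^p. The bound [B] may lie below the norm of [y]; taking it
    to be 0 later detects nonvanishing functionals. *)
Lemma weak_norm_const p (y : E) (B : R) (c : nat -> R) : 0 < p -> 0 <= B -> subprob c ->
  (forall phi, dual_ball phi -> rnorm (phi y) <= B) ->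
  (weak_norm p (fun i => scalar_of_real K (c i `^ p^-1) *: y) <= B%:E)%E.
Proof.
move=> p0 B0 [c0 c1] yB; apply: ge_ereal_sup => _ [phi phi1 <-].
rewrite (_ : (fun i => _) = (fun i => (c i `^ p^-1 * rnorm (phi y))%:E)); last first.
  by apply/funext => i; rewrite linearZ/= rnormZ_real ?powR_ge0.
apply/lnorm_le_fin => [//|i||n]; rewrite ?lee_fin ?mulr_ge0 ?powR_ge0 ?rnorm_ge0//.
under eq_bigr do rewrite /= powRM ?powR_ge0 ?rnorm_ge0// -powRrM mulVf ?gt_eqF// powRr1//.
rewrite sumEFin poweR_EFin lee_fin -mulr_suml -[leRHS]mul1r.
apply: ler_pM; rewrite ?sumr_ge0 ?powR_ge0//.
by apply: ge0_ler_powR; rewrite ?nnegrE ?rnorm_ge0 ?(ltW p0)// yB.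
Qed.

End weak_norm_lemmas.

(** * Multilinear maps on block tuples *)

Section multilinear_lemmas.
Context {R : realType} {K : real_or_complex} {d m : nat}.
Variables (E : 'I_m -> completeNormedModType (scalar_field R K))
  (F : completeNormedModType (scalar_field R K)).

Lemma multilinear_scale (T : (forall j, E j) -> F) (c : 'I_m -> scalar_field R K)
    (x : forall j, E j) :
  multilinear T -> T (fun j => c j *: x j) = (\prod_j c j) *: T x.
Proof.
move=> mT.
have T0 y j : T (dfwith y j 0) = 0.
  have := mT y j 1 0 0; rewrite scaler0 addr0 scale1r -{1}[T _]addr0.
  by move/addrI.
have TZ y j a u : T (dfwith y j (a *: u)) = a *: T (dfwith y j u).
  by have := mT y j a u 0; rewrite addr0 T0 addr0.
(* Coordinates are scaled one after the other along a list without repetitions. *)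
suff TS (s : seq 'I_m) : uniq s ->
    T (fun j => if j \in s then c j *: x j else x j) = (\prod_(j <- s) c j) *: T x.
  rewrite -big_enum -TS ?enum_uniq//; congr T.
  by apply: functional_extensionality_dep => j; rewrite mem_enum.
elim: s => [|i s IH]/=; first by rewrite big_nil scale1r.
move=> /andP[iNs us]; rewrite big_cons -scalerA -IH//.
set y := fun j => if j \in s then _ else _.
have yi : dfwith y i (x i) = y.
  apply: functional_extensionality_dep => j; have [<-|ij] := eqVneq i j.
    by rewrite dfwithin /y (negbTE iNs).
  by rewrite dfwithout.
rewrite -[in RHS]yi -TZ; congr T; apply: functional_extensionality_dep => j.
have [<-|ij] := eqVneq i j; first by rewrite dfwithin mem_head.
by rewrite dfwithout// in_cons eq_sym (negbTE ij).
Qed.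

(** Encodes the partition by the map from coordinates to blocks, so that products over a block
    become products over a fibre of [nu]. *)
Lemma ordered_partition_index (I : 'I_d -> {set 'I_m}) : ordered_partition I ->
  {nu : 'I_m -> 'I_d | forall j k, (j \in I k) = (k == nu j)}.
Proof.
move=> [Iinj /and3P[/eqP cov /finset.trivIsetP triv _]]; apply: cid.
have ex j : {k | j \in I k}.
  apply: cid; have : j \in finset.cover [set I k | k : 'I_d] by rewrite cov.
  by move=> /bigcupP[_ /imsetP[k _ ->]]; exists k.
exists (fun j => sval (ex j)) => j k; case: (ex j) => k' /= jk'.
apply/idP/eqP => [jk|-> //]; apply: contrapT => /eqP kk'.
have Ik : I k != I k' by apply: contra kk' => /eqP/Iinj ->.
have inI l : I l \in [set I k | k : 'I_d] by apply: imset_f.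
have := triv _ _ (inI k) (inI k') Ik.
by move=> /pred0P/(_ j)/=; rewrite jk jk'.
Qed.

Lemma block_tupleE (I : 'I_d -> {set 'I_m}) (nu : 'I_m -> 'I_d)
    (x : forall j, nat -> E j) (l : seq nat) :
  (forall j k, (j \in I k) = (k == nu j)) ->
  block_tuple I x l = (fun k => x k (nth 0%N l (nu k))).
Proof.
move=> Inu; apply: functional_extensionality_dep => k; rewrite /block_tuple.
have single_out j (v : E j) : j != k -> single v k = 0.
  by move=> jk; rewrite /single dfwithout.
rewrite (bigD1 (nu k))//= [X in _ + X]big1 ?addr0.
  rewrite (bigD1 k) ?Inu//= [X in _ + X]big1 ?addr0; first by rewrite /single dfwithin.
  by move=> j /andP[_ jk]; exact: single_out.
move=> n nk; apply: big1 => j jn; apply: single_out.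
by apply: contraNneq nk => <-; rewrite -Inu.
Qed.

Lemma rnorm_block_tuple_scale (I : 'I_d -> {set 'I_m}) (nu : 'I_m -> 'I_d)
    (T : (forall j, E j) -> F) (x : forall j, nat -> E j) (c : 'I_m -> nat -> R)
    (l : seq nat) :
  (forall j k, (j \in I k) = (k == nu j)) -> multilinear T -> (forall j i, 0 <= c j i) ->
  rnorm (T (block_tuple I (fun j i => scalar_of_real K (c j i) *: x j i) l)) =
  \prod_j c j (nth 0%N l (nu j)) * rnorm (T (block_tuple I x l)).
Proof.
move=> Inu mT c0; rewrite !(block_tupleE _ _ Inu) multilinear_scale// rnormZ.
by rewrite scalar_abs_prod; congr (_ * _); apply: eq_bigr => j _; rewrite scalar_abs_real.
Qed.

End multilinear_lemmas.

(** * Finite products of extended reals *)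

Section ereal_products.
Context {R : realType}.
Local Open Scope ereal_scope.

Lemma prodEFin_ord m (W : 'I_m -> R) :
  \prod_(j < m) (W j)%:E = (\prod_(j < m) W j)%:E.
Proof. by elim/big_rec2: _ => // j y z _ ->. Qed.

Lemma lee_prod_ord m (a b : 'I_m -> \bar R) : (forall j, 0 <= a j) ->
  (forall j, a j <= b j) -> \prod_(j < m) a j <= \prod_(j < m) b j.
Proof.
move=> a0 ab; suff /andP[] : 0 <= \prod_(j < m) a j <= \prod_(j < m) b j by [].
elim/big_ind2: _ => [|u v y z /andP[u0 uv] /andP[y0 yz]|j _].
- by rewrite lexx andbT lee_fin.
- by rewrite mule_ge0//= lee_pmul.
- by rewrite a0 ab.
Qed.

End ereal_products.

(** * Transfer of the summing bound from (r; p) to (s; q) *)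

Section inclusion.
Context {R : realType} {K : real_or_complex} {d m : nat}.
Variables (E : 'I_m -> completeNormedModType (scalar_field R K))
  (F : completeNormedModType (scalar_field R K)).

(** At x = 0, with 0^0 = 1, this holds because nonnegative exponents have sum 0 only if all of them
    vanish. *)
Lemma powR_sum (J : finType) (P : pred J) (x : R) (al : J -> R) :
  (forall j, 0 <= al j) ->
  \prod_(j | P j) x `^ al j = x `^ (\sum_(j | P j) al j).
Proof.
move=> al0; suff [] : 0 <= \sum_(j | P j) al j /\
    \prod_(j | P j) x `^ al j = x `^ (\sum_(j | P j) al j) by [].
elim/big_rec2: _ => [|j y z _ [y0 ->]]; first by rewrite powRr0.
split; first exact: addr_ge0.
have [x0|x0] := eqVneq x 0; last by rewrite powRD// x0 implybT.
have [->|aj] := eqVneq (al j) 0; first by rewrite powRr0 mul1r add0r.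
rewrite x0 powR0// mul0r powR0//.
by rewrite gt_eqF// ltr_pwDl// lt_def aj al0.
Qed.

(** Reads a d-tuple as a sequence on [nat]. With default r, the entry at position d is the end value
    s_(d+1) = r. *)
Definition extend_ord (A : Type) (a0 : A) (s : 'I_d -> A) (k : nat) : A :=
  if insub k is Some k' then s k' else a0.

Lemma extend_ordE (A : Type) (a0 : A) s (k : 'I_d) : extend_ord a0 s k = s k.
Proof. by rewrite /extend_ord valK. Qed.

Lemma extend_ord_default (A : Type) (a0 : A) s k : (d <= k)%N -> extend_ord a0 s k = a0.
Proof. by move=> dk; rewrite /extend_ord insubF// ltnNge dk. Qed.

Lemma image_mkseq (A : Type) (a0 : A) s :
  [seq s k | k : 'I_d] = mkseq (extend_ord a0 s) d.
Proof.
rewrite /mkseq -val_enum_ord -map_comp; apply: eq_map => k /=.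
by rewrite extend_ordE.
Qed.

Variables (I : 'I_d -> {set 'I_m}) (nu : 'I_m -> 'I_d).
Hypothesis Inu : forall j k, (j \in I k) = (k == nu j).

Lemma in_tail_blocks (k : 'I_d) j :
  (j \in (\bigcup_(i < d | (k <= i)%N) I i)%SET) = (k <= nu j)%N.
Proof.
apply/finset.bigcupP/idP => [[i ki]|kj]; first by rewrite Inu => /eqP <-.
by exists (nu j); rewrite ?Inu.
Qed.

Lemma summing_bound_inclusion (r : R) (p q : 'I_m -> R) (s : 'I_d -> \bar R)
    (T : (forall j, E j) -> F) (C : R) :
  0 < r -> (forall j, 0 < p j) -> (forall j, p j <= q j) ->
  (forall k, (r%:E <= s k)%E) ->
  (forall k l : 'I_d, (k <= l)%N -> (s l <= s k)%E) ->
  (forall k : 'I_d,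
    ((s k)^-1
       - (\sum_(j in (\bigcup_(i < d | (k <= i)%N) I i)%SET) (q j)^-1)%:E
     = (r^-1
       - \sum_(j in (\bigcup_(i < d | (k <= i)%N) I i)%SET) (p j)^-1)%:E)%E) ->
  multilinear T -> 0 <= C ->
  summing_bound I (fun=> r%:E) p T C -> summing_bound I s q T C.
Proof.
move=> r0 p0 pq rs s_dec spq mT C0 TC x xq.
have q0 j : 0 < q j by exact: lt_le_trans (pq j).
pose W j := fine (weak_norm (q j) (x j)).
have WE j : weak_norm (q j) (x j) = (W j)%:E.
  by rewrite fineK// ge0_fin_numE ?weak_norm_ge0//; exact: xq.
have W0 j : 0 <= W j by rewrite -lee_fin -WE weak_norm_ge0.
under eq_bigr do rewrite WE.
rewrite prodEFin_ord -EFinM; set D := C * _.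
(* [al j] is 1/a_j, and [b k] below is its sum over block k. *)
pose al j := (p j)^-1 - (q j)^-1.
have al0 j : 0 <= al j by rewrite subr_ge0 lef_pV2 ?posrE.
pose b k := \sum_(j | nu j == k :> nat) al j.
pose s' := extend_ord r%:E s.
have s'dec k : (k < d)%N -> (s' k.+1 <= s' k)%E.
  move=> kd; rewrite /s' -[X in (_ <= extend_ord _ _ X)%E]/(val (Ordinal kd)) extend_ordE.
  have [k1d|dk1] := ltnP k.+1 d.
    by rewrite -[X in extend_ord _ _ X]/(val (Ordinal k1d)) extend_ordE s_dec//=.
  by rewrite extend_ord_default.
(* Closed form of 1/s_k; consecutive differences give the recursion with b_k. At k = d the sum is
   empty and the value is 1/r. *)
have s'inv k : (k <= d)%N ->
    ((s' k)^-1 = (r^-1 - \sum_(j | (k <= nu j)%N) al j)%:E)%E.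
  rewrite leq_eqVlt => /predU1P[->|kd].
    rewrite /s' extend_ord_default// big_pred0 ?subr0 ?inver ?gt_eqF// => j.
    by rewrite leqNgt ltn_ord.
  rewrite /s' -[k]/(val (Ordinal kd)) extend_ordE.
  have := spq (Ordinal kd); rewrite !(eq_bigl _ _ (in_tail_blocks _))/=.
  case: ((s _)^-1)%E => [u||]//= -[] /(canRL (subrK _)) ->.
  by rewrite /al sumrB; rewrite opprB addrA addrAC.
rewrite (image_mkseq r%:E).
apply: (@mixed_norm_dual R d s' r b) => //.
- exact: extend_ord_default.
- move=> k kd; rewrite !s'inv// ?(ltnW kd)// -EFinB; congr EFin.
  rewrite (bigID (fun j => nu j == k :> nat))/= opprD addrCA addrC; congr (_ + _ - _).
    by congr (- _); apply: eq_bigl => j; rewrite ltn_neqAle andbC eq_sym.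
  by apply: eq_bigl => j; case: eqP => [->|]; rewrite ?leqnn ?andbF.
- by move=> k _; apply: sumr_ge0.
- by move=> l; rewrite lee_fin rnorm_ge0.
move=> mu mu1.
(* All coordinates of a block get the same weight, so by multilinearity the weights combine to
   mu_k^(b_k). *)
pose x' j i := scalar_of_real K (mu (nu j) i `^ al j) *: x j i.
have x'le j : (weak_norm (p j) (x' j) <= (W j)%:E)%E.
  by rewrite -WE; apply: weak_norm_subprob.
have := TC x' (fun j => le_lt_trans (x'le j) (ltry _)).
rewrite (image_mkseq r%:E) => h.
have -> : nseq d r%:E = mkseq (extend_ord r%:E (fun=> r%:E)) d.
  apply: (@eq_from_nth _ 0%E); rewrite ?size_nseq ?size_mkseq// => i id.
  by rewrite nth_nseq nth_mkseq// id /extend_ord; case: insub.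
apply: le_trans (_ : _ <= C%:E * \prod_(j < m) weak_norm (p j) (x' j))%E _; last first.
  rewrite /D EFinM lee_wpmul2l ?lee_fin// -prodEFin_ord.
  by apply: lee_prod_ord => // j; exact: weak_norm_ge0.
apply: le_trans h; rewrite le_eqVlt; apply/orP; left; apply/eqP.
apply: eq_mixed_norm => l _; rewrite -EFinM; congr EFin.
rewrite (rnorm_block_tuple_scale _ _ Inu)//; last by move=> *; exact: powR_ge0.
congr (_ * _); rewrite (partition_big nu predT)//=.
apply: eq_bigr => k _; rewrite /b -powR_sum//.
by apply: eq_big => [j|j /eqP ->].
Qed.

End inclusion.

(** * Rank one operators and the lower bound for the norm *)

Section optimality.
Context {R : realType} {K : real_or_complex} {d m : nat}.
Variables (E : 'I_m -> completeNormedModType (scalar_field R K))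
  (F : completeNormedModType (scalar_field R K)).

Local Notation "'N_ p [ f ]" := (Lnorm counting p f).

(** Each norm dominates its coordinates, so all indices but the k-th may be frozen at 0. *)
Lemma le_mixed_norm_slice (ts : seq (\bar R)) (f : seq nat -> \bar R) k :
  all (fun t => 0 < t)%E ts -> (forall l, 0 <= f l)%E -> (k < size ts)%N ->
  ('N_(nth 0 ts k)[(fun i => f (set_nth 0%N (nseq (size ts) 0%N) k i))]
    <= mixed_norm ts f)%E.
Proof.
elim: ts f k => [|t ts IH] f [|k]//= /andP[t0 ts0] f0 kts.
  apply: le_lnorm => // i.
  exact: (@le_mixed_norm_coord R ts (fun l => f (i :: l)) (nseq (size ts) 0%N)
           ts0 _ (size_nseq _ _)).
apply: le_trans (IH (fun l => f (0%N :: l)) k ts0 _ kts) _ => //.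
apply: (@le_lnorm_coord R t (fun i => mixed_norm ts (fun l => f (i :: l))) 0%N) => // i.
exact: mixed_norm_ge0.
Qed.

(** Divide phi by its norm, which is positive as phi(y) is nonzero. The norm need not be attained,
    hence the points are norming only up to e. *)
Lemma dual_ball_normalize (V : completeNormedModType (scalar_field R K)) (y : V)
    (phi : {linear V -> (scalar_field R K)^o}) :
  dual_ball phi -> 0 < rnorm (phi y) ->
  exists psi : {linear V -> (scalar_field R K)^o}, dual_ball psi /\
    forall e, 0 < e -> exists z, rnorm z <= 1 /\ 1 - e < rnorm (psi z).
Proof.
move=> [phi_cont phi1] phiy.
have y0 : 0 < rnorm y by apply: lt_le_trans phiy _; exact: dual_norm_le.
have dn_gt0 : (0 < dual_norm phi)%E.
  apply: lt_le_trans (ereal_sup_ubound (_ : _ (rnorm (phi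
    (scalar_of_real K (rnorm y)^-1 *: y)))%:E)).
    by rewrite linearZ/= lte_fin rnormZ_real ?invr_ge0 ?rnorm_ge0// mulr_gt0 ?invr_gt0.
  exists (scalar_of_real K (rnorm y)^-1 *: y) => //=.
  by rewrite rnormZ_real ?invr_ge0 ?rnorm_ge0// mulVf// gt_eqF.
have dn_fin : dual_norm phi \is a fin_num.
  by rewrite ge0_fin_numE ?ltW// (le_lt_trans phi1)// ltry.
pose a := fine (dual_norm phi); have aE : dual_norm phi = a%:E by rewrite fineK.
have a0 : 0 < a by rewrite -lte_fin -aE.
have ai0 : 0 <= a^-1 by rewrite invr_ge0 ltW.
pose psi : {linear V -> (scalar_field R K)^o} :=
  (scalar_of_real K a^-1) \*: phi.
have psiE z : rnorm (psi z) = a^-1 * rnorm (phi z) by rewrite /= rnormZ_real.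
have phi_le z : rnorm z <= 1 -> rnorm (phi z) <= a.
  by move=> z1; rewrite -lee_fin -aE; apply: ereal_sup_ubound; exists z.
exists psi; split; first split.
- by move=> z; exact: cvgZl_tmp (phi_cont z).
- apply: ge_ereal_sup => _ [z /phi_le z1 <-].
  by rewrite lee_fin psiE mulrC ler_pdivrMr// mul1r.
move=> e e0.
have [_ [z z1 <-]] := ub_ereal_sup_adherent (mulr_gt0 e0 a0) dn_fin.
rewrite -/(dual_norm phi) aE -EFinB lte_fin => h.
by exists z; split => //; rewrite psiE mulrC ltr_pdivlMr// mulrBl mul1r.
Qed.

Definition rank_one (psi : forall j, {linear E j -> (scalar_field R K)^o}) (v : F)
  (x : forall j, E j) : F := (\prod_j (psi j (x j) : scalar_field R K)) *: v.

Lemma multilinear_rank_one psi v : multilinear (rank_one psi v).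
Proof.
move=> x j a u w.
set Q := \prod_(i < m | i != j) (psi i (x i) : scalar_field R K).
have prodE z : \prod_(i < m) (psi i (dfwith x j z i) : scalar_field R K) = psi j z * Q.
  rewrite (bigD1 j)//= dfwithin; congr (_ * _).
  by apply: eq_bigr => i ij; rewrite dfwithout// eq_sym.
rewrite /rank_one !prodE linearP scalerA -scalerDl; congr (_ *: _).
by rewrite mulrDl mulrA.
Qed.

Lemma rnorm_rank_one psi v x :
  rnorm (rank_one psi v x) = (\prod_j rnorm (psi j (x j))) * rnorm v.
Proof. by rewrite /rank_one rnormZ scalar_abs_prod. Qed.

Variables (I : 'I_d -> {set 'I_m}) (nu : 'I_m -> 'I_d).
Hypothesis Inu : forall j k, (j \in I k) = (k == nu j).

(** Tests the bound on the sequences c_i^(1/u_j) y_j with one weight per block; by homogeneity only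
    a scalar weight multiplies T(y). *)
Lemma summing_bound_const (t : 'I_d -> \bar R) (u : 'I_m -> R)
    (T : (forall j, E j) -> F) (C : R) (y : forall j, E j) (B : 'I_m -> R)
    (c : nat -> nat -> R) :
  multilinear T -> summing_bound I t u T C -> 0 <= C ->
  (forall j, 0 < u j) -> (forall j, 0 <= B j) -> (forall k, subprob (c k)) ->
  (forall j phi, dual_ball phi -> rnorm (phi (y j)) <= B j) ->
  (mixed_norm [seq t k | k : 'I_d] (fun l =>
     ((\prod_j c (nu j) (nth 0%N l (nu j)) `^ (u j)^-1) * rnorm (T y))%:E)
   <= (C * \prod_j B j)%:E)%E.
Proof.
move=> mT TC C0 u0 B0 c1 yB.
pose x j (i : nat) := scalar_of_real K (c (nu j) i `^ (u j)^-1) *: y j.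
have xB j : (weak_norm (u j) (x j) <= (B j)%:E)%E.
  by apply: weak_norm_const => //; exact: yB.
have := TC x (fun j => le_lt_trans (xB j) (ltry _)).
rewrite EFinM -prodEFin_ord => h.
apply: le_trans (le_trans h _); last first.
  by rewrite lee_wpmul2l ?lee_fin//; apply: lee_prod_ord => // j; exact: weak_norm_ge0.
rewrite le_eqVlt; apply/orP; left; apply/eqP; apply: eq_mixed_norm => l _.
rewrite (@rnorm_block_tuple_scale _ _ _ _ _ _ _ _ _ (fun j _ => y j)
  (fun j i => c (nu j) i `^ (u j)^-1) _ Inu)//; last by move=> *; exact: powR_ge0.
by rewrite (block_tupleE _ _ Inu).
Qed.

Lemma all_gt0_image (t : 'I_d -> \bar R) : (forall k, 0 < t k)%E ->
  all (fun t => 0 < t)%E [seq t k | k : 'I_d].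
Proof. by move=> t0; apply/allP => _ /mapP[k _ ->]. Qed.

(** Dirac weights give the test sequences (y_j, 0, 0, ..). *)
Lemma summing_bound_point (t : 'I_d -> \bar R) (u : 'I_m -> R)
    (T : (forall j, E j) -> F) (C : R) (y : forall j, E j) (B : 'I_m -> R) :
  multilinear T -> summing_bound I t u T C -> 0 <= C ->
  (forall k, 0 < t k)%E -> (forall j, 0 < u j) -> (forall j, 0 <= B j) ->
  (forall j phi, dual_ball phi -> rnorm (phi (y j)) <= B j) ->
  rnorm (T y) <= C * \prod_j B j.
Proof.
move=> mT TC C0 t0 u0 B0 yB; rewrite -lee_fin.
apply: le_trans (summing_bound_const mT TC C0 u0 B0 (fun=> subprob_dirac 0%N) yB).
apply: le_trans (le_mixed_norm_coord (l := nseq d 0%N) (all_gt0_image t0) _ _).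
- rewrite big1 ?mul1r// => j _; rewrite nth_nseq ltn_ord eqxx powR1//.
- by move=> l; rewrite lee_fin mulr_ge0 ?rnorm_ge0// prodr_ge0// => *; exact: powR_ge0.
- by rewrite size_nseq size_map size_enum_ord.
Qed.

(** Take uniform weights on N points for block k and Dirac weights elsewhere. The bound becomes N^(1
    - P r) |T(y)|^r <= D^r for all N >= 1, which excludes 1 - P r > 0. *)
Lemma summing_exponents (r : R) (p : 'I_m -> R) (T : (forall j, E j) -> F)
    (C : R) (y : forall j, E j) (k : 'I_d) :
  multilinear T -> summing_bound I (fun=> r%:E) p T C -> 0 <= C ->
  0 < r -> (forall j, 0 < p j) -> T y != 0 ->
  r^-1 <= \sum_(j | nu j == k) (p j)^-1.
Proof.
move=> mT TC C0 r0 p0 Ty; set P := \sum_(j | _) _.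
rewrite leNgt; apply/negP => Pr.
have {}Ty := rnorm_gt0 Ty.
set D := C * \prod_j rnorm (y j).
have D0 : 0 <= D by rewrite mulr_ge0// prodr_ge0// => *; exact: rnorm_ge0.
have del0 : 0 < 1 - P * r by rewrite subr_gt0 -ltr_pdivlMr// div1r.
have bound N : (0 < N)%N -> N%:R `^ (1 - P * r) <= D `^ r / rnorm (T y) `^ r.
  move=> N0; have N0' : (0 : R) < N%:R by rewrite ltr0n.
  pose c k' := if k' == k :> nat then fun i => if (i < N)%N then N%:R^-1 else 0
    else fun i => (i == 0%N)%:R : R.
  have c1 k' : subprob (c k').
    by rewrite /c; case: ifP => _; [exact: subprob_uniform|exact: subprob_dirac].
  have := summing_bound_const mT TC C0 p0 (fun j => rnorm_ge0 (y j)) c1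
    (fun j phi phi1 => dual_norm_le (y j) phi1.2).
  rewrite -/D => h.
  have sz : size [seq (fun=> r%:E) k | k : 'I_d] = d by rewrite size_map size_enum_ord.
  have f0 l : (0 <= ((\prod_j c (nu j) (nth 0%N l (nu j)) `^ (p j)^-1) * rnorm (T y))%:E)%E.
    by rewrite lee_fin mulr_ge0 ?rnorm_ge0// prodr_ge0// => *; exact: powR_ge0.
  have kd : (k < size [seq (fun=> r%:E : \bar R) k | k : 'I_d])%N by rewrite sz.
  have r0' (k' : 'I_d) : (0 < (fun=> r%:E : \bar R) k')%E by rewrite lte_fin.
  have := le_trans (le_mixed_norm_slice (all_gt0_image r0') f0 kd) h.
  rewrite (_ : nth _ _ _ = r%:E); last first.
    by rewrite (nth_map k) ?size_enum_ord.
  rewrite sz.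
  have D0' : (0 <= D%:E)%E by rewrite lee_fin.
  move=> /(lnorm_le_fin r0 (fun i => f0 _) D0')/(_ N).
  rewrite big_nat_cond (eq_bigr (fun=> ((N%:R `^ (- (P * r))) * rnorm (T y) `^ r)%:E)).
    rewrite -big_nat_cond sumEFin sumr_const_nat subn0 poweR_EFin lee_fin.
    rewrite -[leLHS]mulr_natl mulrA -{1}[N%:R]powRr1 ?ler0n// -powRD; last first.
      by rewrite (gt_eqF N0') implybT.
    by rewrite ler_pdivlMr// powR_gt0.
  move=> i /andP[/andP[_ iN] _]; rewrite poweR_EFin; congr EFin.
  rewrite powRM ?rnorm_ge0 ?prodr_ge0//; last by move=> *; exact: powR_ge0.
  congr (_ * _).
  rewrite (bigID (fun j => nu j == k))/= [X in _ * X]big1 ?mulr1; last first.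
    move=> j jk; rewrite /c val_eqE (negbTE jk) nth_set_nth/= val_eqE (negbTE jk).
    by rewrite nth_nseq ltn_ord eqxx powR1.
  rewrite (eq_bigr (fun j => N%:R^-1 `^ (p j)^-1)); last first.
    by move=> j /eqP jk; rewrite /c jk eqxx nth_set_nth/= eqxx iN.
  rewrite powR_sum; last by move=> j; rewrite invr_ge0 ltW.
  by rewrite -powRrM -/P -powR_inv1 ?ler0n// -powRrM mulN1r.
set M := D `^ r / rnorm (T y) `^ r.
have M0 : 0 <= M by rewrite divr_ge0 ?powR_ge0.
(* This N exceeds M^(1/(1 - P r)), so N^(1 - P r) > M. *)
have := bound (Num.truncn (M `^ (1 - P * r)^-1)).+1 isT; rewrite -/M leNgt => /negP; apply.
have := @gt0_ltr_powR _ _ del0 _ _ _ _ (truncnS_gt (M `^ (1 - P * r)^-1)).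
rewrite -powRrM mulVf ?gt_eqF// powRr1//.
by apply; rewrite nnegrE ?powR_ge0 ?ler0n.
Qed.

(** The integrand is a product of one function per block index, so the mixed norm is a product of
    l_r-norms; Hoelder inside each block uses the condition on r and the p_j. *)
Lemma summing_bound_rank_one (r : R) (p : 'I_m -> R)
    (psi : forall j, {linear E j -> (scalar_field R K)^o}) (v : F) :
  0 < r -> (forall j, 0 < p j) ->
  (forall k : 'I_d, r^-1 <= \sum_(j | nu j == k) (p j)^-1) ->
  (forall j, dual_ball (psi j)) -> rnorm v = 1 ->
  summing_bound I (fun=> r%:E) p (rank_one psi v) 1.
Proof.
move=> r0 p0 rp psi1 v1 x xp.
pose W j := fine (weak_norm (p j) (x j)).
have WE j : weak_norm (p j) (x j) = (W j)%:E.
  by rewrite fineK// ge0_fin_numE ?weak_norm_ge0//; exact: xp.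
have W0 j : 0 <= W j by rewrite -lee_fin -WE weak_norm_ge0.
under eq_bigr do rewrite WE.
rewrite prodEFin_ord mul1e.
pose g (k i : nat) := \prod_(j | nu j == k :> nat) rnorm (psi j (x j i)).
have g0 k i : 0 <= g k i by apply: prodr_ge0 => *; exact: rnorm_ge0.
have gW k : (k < d)%N ->
    ('N_r%:E[EFin \o g k] <= (\prod_(j | nu j == k :> nat) W j)%:E)%E.
  move=> kd; apply: (@lnorm_prod_le R _ _ r p W (fun j i => rnorm (psi j (x j i)))) => //.
  - by move=> *; exact: rnorm_ge0.
  - exact: (rp (Ordinal kd)).
  - by move=> j _; rewrite -WE; apply: ereal_sup_ubound; exists (psi j).
pose G k := fine 'N_r%:E[EFin \o g k].
have GE k : (k < d)%N -> 'N_r%:E[EFin \o g k] = (G k)%:E.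
  move=> /gW kW; rewrite fineK// ge0_fin_numE ?Lnorm_ge0//.
  exact: le_lt_trans kW (ltry _).
have sz : size [seq (fun=> r%:E) k | k : 'I_d] = d by rewrite size_map size_enum_ord.
have nthr n : (n < d)%N -> nth 0%E [seq (fun=> r%:E : \bar R) k | k : 'I_d] n = r%:E.
  by move=> nd; rewrite (nth_map (Ordinal nd)) ?size_enum_ord.
have r0' (k' : 'I_d) : (0 < (fun=> r%:E : \bar R) k')%E by rewrite lte_fin.
have := @mixed_norm_prod R [seq (fun=> r%:E : \bar R) k | k : 'I_d] g G
  (all_gt0_image r0') g0; rewrite sz => mixE.
rewrite (_ : (fun l => _) = (fun l => (\prod_(n < d) g n (nth 0%N l n))%:E)); last first.
  apply/funext => l; rewrite (block_tupleE _ _ Inu) rnorm_rank_one v1 mulr1.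
  congr EFin; rewrite (partition_big nu predT)//=; apply: eq_bigr => k _.
  by apply: eq_big => [j|j /eqP ->].
rewrite mixE; last by move=> n nd; rewrite nthr// GE.
rewrite lee_fin (partition_big nu predT)//=.
apply: ler_prod => k _; rewrite -!lee_fin -GE// Lnorm_ge0/=.
by apply: le_trans (gW k (ltn_ord k)) _.
Qed.

Lemma bernoulli_ineq (e : R) n : 0 <= e -> e <= 1 -> 1 - n%:R * e <= (1 - e) ^+ n.
Proof.
move=> e0 e1; elim: n => [|n IH]; first by rewrite mul0r subr0 expr0.
rewrite exprS; apply: le_trans (ler_wpM2l _ IH); rewrite ?subr_ge0//.
rewrite -subr_ge0 (_ : _ - _ = n%:R * e ^+ 2) ?mulr_ge0 ?ler0n ?exprn_ge0//.
by rewrite -natr1; ring.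
Qed.

(** Almost norming points z_j give (1 - e')^m <= C, and Bernoulli turns this into 1 - e <= C. *)
Lemma summing_bound_rank_one_ge1 (t : 'I_d -> \bar R) (u : 'I_m -> R)
    (psi : forall j, {linear E j -> (scalar_field R K)^o}) (v : F) (C : R) :
  (forall k, 0 < t k)%E -> (forall j, 0 < u j) -> rnorm v = 1 -> 0 < C ->
  (forall j e, 0 < e -> exists z, rnorm z <= 1 /\ 1 - e < rnorm (psi j z)) ->
  summing_bound I t u (rank_one psi v) C -> 1 <= C.
Proof.
move=> t0 u0 v1 C0 near1 TC; apply/ler_addgt0Pr => e e0.
have [e1|e1] := ltP e 1; last by rewrite (le_trans e1)// lerDr (ltW C0).
(* Chosen so that m e' <= e, with a denominator that is never 0. *)
pose e' := e / m.+1%:R.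
have e'0 : 0 < e' by rewrite divr_gt0// ltr0n.
have e'1 : e' <= 1.
  by rewrite ler_pdivrMr ?ltr0n// mul1r (le_trans (ltW e1))// ler1n.
pose z j := sval (cid (near1 j e' e'0)).
have zP j : rnorm (z j) <= 1 /\ 1 - e' < rnorm (psi j (z j)).
  exact: (svalP (cid (near1 j e' e'0))).
have := summing_bound_point (y := z) (B := fun=> 1) (multilinear_rank_one psi v) TC
  (ltW C0) t0 u0 (fun=> ler01)
  (fun j phi phi1 => le_trans (dual_norm_le (z j) phi1.2) (zP j).1).
rewrite rnorm_rank_one v1 mulr1 [X in C * X]big1// mulr1 => le_C.
have : (1 - e') ^+ m <= C.
  apply: le_trans le_C; rewrite -[X in _ ^+ X]card_ord -prodr_const.
  by apply: ler_prod => j _; rewrite subr_ge0 e'1 ltW//; exact: (zP j).2.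
have := bernoulli_ineq m (ltW e'0) e'1 => h1 h2.
have : m%:R * e' <= e.
  by rewrite /e' mulrCA ger_pMr// ler_pdivrMr ?ltr0n// mul1r ler_nat.
lra.
Qed.

End optimality.

(** * Inclusion of the classes and norm of the inclusion operator *)

Theorem theorem3p2 (R : realType) (K : real_or_complex) (d m : nat)
    (hd : (1 <= d)%N) (hdm : (d <= m)%N)
    (I : 'I_d -> {set 'I_m}) (hI : ordered_partition I)
    (r : R) (p q : 'I_m -> R) (s : 'I_d -> \bar R)
    (hr : 1 <= r) (hp : forall j, 1 <= p j) (hq : forall j, 1 <= q j)
    (hrs : forall k, (r%:E <= s k)%E)
    (hs : forall k l : 'I_d, (k <= l)%N -> (s l <= s k)%E)
    (hspq : forall k : 'I_d,
      ((s k)^-1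
         - (\sum_(j in (\bigcup_(i < d | (k <= i)%N) I i)%SET) (q j)^-1)%:E
       = (r^-1
         - \sum_(j in (\bigcup_(i < d | (k <= i)%N) I i)%SET) (p j)^-1)%:E)%E)
    (hAB :
      ((forall j, p j <= q j) /\
        0 < r^-1 - \sum_(j < m) (p j)^-1 + \sum_(j < m) (q j)^-1)
      \/
      ((forall j : 'I_m, j = 0%N :> nat -> p j < q j) /\
        (forall j : 'I_m, (0 < j)%N -> p j <= q j) /\
        r^-1 - \sum_(j < m) (p j)^-1 + \sum_(j < m) (q j)^-1 = 0))
    (E : 'I_m -> completeNormedModType (scalar_field R K))
    (F : completeNormedModType (scalar_field R K)) :
  (summing I (fun=> r%:E) p `<=` (summing I s q : set ((forall j, E j) -> F)))%classic
  /\ ((exists2 T : (forall j, E j) -> F,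
         summing I (fun=> r%:E) p T & exists x, T x != 0) ->
      inclusion_norm E F I (fun=> r%:E) p s q = 1%E).
Proof.
have [nu Inu] := ordered_partition_index hI.
have r0 : 0 < r by exact: lt_le_trans hr.
have p0 j : 0 < p j by exact: lt_le_trans (hp j).
have q0 j : 0 < q j by exact: lt_le_trans (hq j).
(* Both alternatives yield this; coordinate 0 carries the strict inequality of (B). *)
have pq j : p j <= q j.
  case: hAB => [[]//|[h0 [h1 _]]].
  by have [j0|j0] := posnP j; [exact/ltW/h0|exact: h1].
have s0 k : (0 < s k)%E by apply: lt_le_trans (hrs k); rewrite lte_fin.
have incl (T : (forall j, E j) -> F) C : multilinear T -> 0 < C ->
    summing_bound I (fun=> r%:E) p T C -> summing_bound I s q T C.
  by move=> mT C0; apply: (summing_bound_inclusion Inu) => //; exact: ltW.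
split=> [T [mT [C [C0 TC]]]|[T [mT [C [C0 TC]]] [x Tx]]].
  by split=> //; exists C; split=> //; exact: incl.
apply/eqP; rewrite eq_le; apply/andP; split.
  (* Every constant for (r; p) is one for (s; q), so the second infimum is no larger. *)
  apply: ge_ereal_sup => _ [S [[mS _] S1] <-]; apply: le_trans S1.
  apply: ereal_inf_le_tmp => _ [c [c0 cS] <-]; exists c => //.
  by split=> //; exact: incl.
have rp k := summing_exponents Inu k mT TC (ltW C0) r0 p0 Tx.
have nTx := rnorm_gt0 Tx.
(* Otherwise the test sequence [x j, 0, 0, ..] has weak norm 0. *)
have psiP j : exists psi : {linear E j -> (scalar_field R K)^o}, dual_ball psi /\
    forall e, 0 < e -> exists z, rnorm z <= 1 /\ 1 - e < rnorm (psi z).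
  suff [phi [phi1 phix]] : exists phi : {linear E j -> (scalar_field R K)^o},
      dual_ball phi /\ 0 < rnorm (phi (x j)).
    exact: dual_ball_normalize phi1 phix.
  apply: contrapT => /forallNP phiN.
  have : rnorm (T x) <= C * \prod_i (if i == j then 0 else rnorm (x i)).
    apply: (summing_bound_point Inu mT TC (ltW C0)) => //= i.
    - by case: ifP => // _; exact: rnorm_ge0.
    - move=> phi phi1; case: eqP => [ij|_]; last exact: dual_norm_le phi1.2.
      move: phi phi1; rewrite ij => phi phi1.
      by rewrite leNgt; apply/negP => phix; apply: (phiN phi).
  by rewrite (bigD1 j)//= eqxx mul0r mulr0 leNgt nTx.
pose psi j := sval (cid (psiP j)).
have psi1 j : dual_ball (psi j) by exact: (svalP (cid (psiP j))).1.
have psi_near j := (svalP (cid (psiP j))).2.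
pose v := scalar_of_real K (rnorm (T x))^-1 *: T x.
have v1 : rnorm v = 1.
  by rewrite rnormZ_real ?invr_ge0 ?rnorm_ge0// mulVf// gt_eqF.
have bound1 := summing_bound_rank_one Inu r0 p0 rp psi1 v1.
have mS := @multilinear_rank_one R K m E F psi v.
(* The rank one operator lies in the unit ball of the (r; p)-class, and each of its (s; q)-constants
   is at least 1. *)
apply: le_trans (ereal_sup_ubound (_ : _ (summing_norm I s q (rank_one psi v)))).
  apply: le_ereal_inf_tmp => _ [c [c0 cS] <-]; rewrite lee_fin.
  exact: (summing_bound_rank_one_ge1 Inu s0 q0 v1 c0 psi_near cS).
exists (rank_one psi v) => //; split.
  by split=> //; exists 1.
by apply: ereal_inf_lbound; exists 1.
Qed.
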